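(* Let $\pi = \{I_1,\ldots,I_m\}$ be a partition of $\{1,\ldots,N\}$, where $N \ge 1$. Let $\overline{\mathcal{S}_\pi}$ and $\mathbb{C}^{m\times m}$ be equipped with the entrywise product, so that the units for this product are $\mathbf{1}_{N\times N}$ and $\mathbf{1}_{m \times m}$, respectively. The maps \[ \Sigma^\downarrow_\pi : \overline{\mathcal{S}_\pi} \to \mathbb{C}^{m\times m} \qquad\text{and}\qquad \Sigma^\uparrow_\pi : \mathbb{C}^{m \times m} \to \overline{\mathcal{S}_\pi} \] are mutually inverse, rank-preserving isomorphisms of unital $*$-algebras. Moreover, a matrix $A \in \overline{\mathcal{S}_\pi}$ is positive semidefinite if and only if $\Sigma^\downarrow_\pi(A)$ is.
   Context: $\mathcal{S}_\pi$ is the set of $A \in \mathbb{C}^{N\times N}$ for which $\pi$ is the coarsest partition such that $A$ is constant on each block $I_i \times I_j$; its closure $\overline{\mathcal{S}_\pi}$ is the set of all $A\in\mathbb{C}^{N\times N}$ that are constant on each block $I_i \times I_j$, $1 \le i,j\le m$. $\mathbf{1}_{k\times k}$ is the $k\times k$ matrix with all entries $1$. Inflation: $\Sigma^\uparrow_\pi : \mathbb{C}^{m\times m}\to\mathbb{C}^{N \times N}$ is the linear map with $E_{ij} \mapsto \mathbf{1}_{I_i \times I_j}$, where $E_{ij}$ is the elementary matrix with $(i,j)$ entry $1$ and other entries $0$, and $\mathbf{1}_{I_i\times I_j}$ is the $N\times N$ matrix with $1$ in each entry of the $I_i\times I_j$ block and $0$ elsewhere; its range is $\overline{\mathcal{S}_\pi}$.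 Compression: $\Sigma^\downarrow_\pi : \mathbb{C}^{N\times N} \to \mathbb{C}^{m\times m}$ is the linear map $\Sigma^\downarrow_\pi(A)_{ij} := \frac{1}{|I_i|\,|I_j|} \sum_{p \in I_i,\, q\in I_j} a_{pq}$. The involution $*$ is the conjugate transpose. *)

(* Defs.v *)
From HB Require Import structures.
From mathcomp Require Import all_boot all_order all_algebra.
From mathcomp Require Import sesquilinear spectral.
From mathcomp Require Export reals complex.

Set Implicit Arguments.
Unset Strict Implicit.
Unset Printing Implicit Defensive.

Import Order.TTheory GRing.Theory Num.Theory.
Local Open Scope ring_scope.
Local Open Scope sesquilinear_scope.

(* The algebra laws are those of [algType]; only the conjugate-linear         *)
(* involution is new. [linear f] is linearity over C, and [monoid_morphism f] *)
(* says f 1 = 1 and f (x * y) = f x * f y.                                    *)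
HB.mixin Record Algebra_isStar (C : numClosedFieldType) A
    of GRing.Algebra C A := {
  star : A -> A;
  starK : involutive star;
  starD : {morph star : x y / x + y};
  starZ : forall (a : C) (x : A), star (a *: x) = a^* *: star x;
  starM : forall x y : A, star (x * y) = star y * star x
}.

#[short(type="starAlgType")]
HB.structure Definition StarAlgebra (C : numClosedFieldType) :=
  {A of GRing.Algebra C A & Algebra_isStar C A}.

Definition star_alg_morphism (C : numClosedFieldType) (A B : starAlgType C)
    (f : A -> B) : Prop :=
  [/\ linear f, monoid_morphism f & {morph f : x / star x}].

Definition mutually_inverse_star_alg_isos (C : numClosedFieldType)
    (A B : starAlgType C) (f : A -> B) (g : B -> A) : Prop :=
  [/\ star_alg_morphism f, star_alg_morphism g, cancel f g & cancel g f].

(* An alias of 'M[C]_n, so that its canonical product is the entrywise one    *)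
(* and not matrix multiplication. An [algType] is nontrivial, hence the       *)
(* positive dimension in the algebra instances below.                         *)
Definition hmx (C : numClosedFieldType) (n : nat) : Type := 'M[C]_n.

Section Hadamard.
Variable C : numClosedFieldType.

HB.instance Definition _ n := GRing.Lmodule.on (hmx C n).

Section Ring.
Variable n : nat.
Implicit Types A B D : hmx C n.+1.

Definition hmx1 : hmx C n.+1 := const_mx 1.
Definition hmx_mul A B : hmx C n.+1 := map2_mx *%R A B.

Fact hmx_mulA : associative hmx_mul.
Proof. by move=> A B D; apply/matrixP=> i j; rewrite !mxE mulrA. Qed.
Fact hmx_mulC : commutative hmx_mul.
Proof. by move=> A B; apply/matrixP=> i j; rewrite !mxE mulrC. Qed.
Fact hmx_mul1 : left_id hmx1 hmx_mul.
Proof. by move=> A; apply/matrixP=> i j; rewrite !mxE mul1r. Qed.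
Fact hmx_mulDl : left_distributive hmx_mul +%R.
Proof. by move=> A B D; apply/matrixP=> i j; rewrite !mxE mulrDl. Qed.
Fact hmx1_neq0 : hmx1 != 0.
Proof. by apply/eqP=> /matrixP/(_ 0 0)/eqP; rewrite !mxE oner_eq0. Qed.

HB.instance Definition _ := GRing.Zmodule_isComNzRing.Build (hmx C n.+1)
  hmx_mulA hmx_mulC hmx_mul1 hmx_mulDl hmx1_neq0.

Lemma hmx1E : (1 : hmx C n.+1) = const_mx 1.
Proof. by []. Qed.
Lemma hmxME A B : A * B = map2_mx *%R A B.
Proof. by []. Qed.

Fact hmx_scaleAl (a : C) A B : a *: (A * B) = (a *: A : hmx C n.+1) * B.
Proof. by rewrite !hmxME; apply/matrixP=> i j; rewrite !mxE mulrA. Qed.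

HB.instance Definition _ :=
  GRing.Lmodule_isLalgebra.Build C (hmx C n.+1) hmx_scaleAl.
HB.instance Definition _ := GRing.Lalgebra_isComAlgebra.Build C (hmx C n.+1).

Definition hmx_star A : hmx C n.+1 := A ^t*.

Fact hmx_starK : involutive hmx_star.
Proof. by move=> A; apply/matrixP=> i j; rewrite !mxE conjCK. Qed.
Fact hmx_starD : {morph hmx_star : A B / A + B}.
Proof. by move=> A B; apply/matrixP=> i j; rewrite !mxE rmorphD. Qed.
Fact hmx_starZ (a : C) A : hmx_star (a *: A) = a^* *: hmx_star A.
Proof. by apply/matrixP=> i j; rewrite !mxE rmorphM. Qed.
Fact hmx_starM A B : hmx_star (A * B) = hmx_star B * hmx_star A.
Proof. 
by rewrite !hmxME; apply/matrixP=> i j; rewrite !mxE rmorphM mulrC.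
Qed.

HB.instance Definition _ := Algebra_isStar.Build C (hmx C n.+1)
  hmx_starK hmx_starD hmx_starZ hmx_starM.

End Ring.
End Hadamard.

(* The blocks are numbered by 'I_m; [partition] makes them nonempty,          *)
(* pairwise disjoint and covering, and injectivity makes them distinct. When  *)
(* N is positive so is m.                                                     *)
Record numbered_partition (N m : nat) := NumberedPartition {
  block :> 'I_m -> {set 'I_N};
  block_inj : injective block;
  block_partition : partition [set block i | i : 'I_m] [set: 'I_N]
}.

Section Blocks.
Variable C : numClosedFieldType.

Definition block_constant N m (P : numbered_partition N m) (A : hmx C N) : bool :=
  [forall i, forall j,
    forall p in P i, forall p' in P i, forall q in P j, forall q' in P j,
      A p q == A p' q'].

Definition indic_mx N (I J : {set 'I_N}) : 'M[C]_N :=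
  \matrix_(p, q) ((p \in I) && (q \in J))%:R.

(* The linear map sending [delta_mx i j] to [indic_mx (P i) (P j)]. *)
Definition inflate N m (P : numbered_partition N m) (B : 'M[C]_m) : 'M[C]_N :=
  \sum_(i < m) \sum_(j < m) B i j *: indic_mx (P i) (P j).

Definition compress N m (P : numbered_partition N m) (A : 'M[C]_N) : 'M[C]_m :=
  \matrix_(i, j) ((#|P i|%:R * #|P j|%:R)^-1 *
                  \sum_(p in P i) \sum_(q in P j) A p q).

Definition psdmx n (A : 'M[C]_n) : Prop :=
  A \is hermsymmx /\ forall x : 'cV[C]_n, 0 <= (x ^t* *m A *m x) 0 0.

Lemma block_constantP N m (P : numbered_partition N m) (A : hmx C N) :
  reflect (forall i j p p' q q', p \in P i -> p' \in P i -> q \in P j ->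
             q' \in P j -> A p q = A p' q')
          (block_constant P A).
Proof.
apply: (iffP 'forall_'forall_'forall_in_'forall_in_'forall_in_'forall_in_eqP).
  by move=> AP i j p p' q q' ? ? ? ?; apply: (AP i j).
by move=> AP i j p ? p' ? q ? q' ?; apply: (AP i j).
Qed.

Lemma block_mem_eq N m (P : numbered_partition N m) i j p :
  p \in P i -> p \in P j -> i = j.
Proof.
move=> Pip Pjp; apply: (@block_inj _ _ P); apply/eqP; apply: contraT => Pij.
case/and3P: (block_partition P) => _ /trivIsetP tP _.
have := tP _ _ (imset_f _ (erefl : i \in 'I_m)) (imset_f _ (erefl : j \in 'I_m)).
by move=> /(_ Pij) /disjointFr /(_ Pip); rewrite Pjp.
Qed.

Lemma inflate_block_constant N m (P : numbered_partition N m) (B : 'M[C]_m) :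
  block_constant P (inflate P B).
Proof.
apply/block_constantP => i j p p' q q' Pp Pp' Pq Pq'.
rewrite !summxE; apply: eq_bigr => k _; rewrite !summxE; apply: eq_bigr => l _.
rewrite !mxE; congr (_ * (_ && _)%:R).
  by apply/idP/idP=> /block_mem_eq; [move/(_ _ Pp) | move/(_ _ Pp')] => ->.
by apply/idP/idP=> /block_mem_eq; [move/(_ _ Pq) | move/(_ _ Pq')] => ->.
Qed.

Record blockmx N m (P : numbered_partition N m) := BlockMx {
  blockmx_val : hmx C N;
  blockmxP : block_constant P blockmx_val
}.

HB.instance Definition _ N m (P : numbered_partition N m) :=
  [isSub for @blockmx_val N m P].
HB.instance Definition _ N m (P : numbered_partition N m) :=
  [Choice of blockmx P by <:].

Section Algebra.
Variables (N m : nat) (P : numbered_partition N.+1 m).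

Fact block_constant_subalg :
  GRing.subsemialg_closed (block_constant P : {pred hmx C N.+1}).
Proof.
split; [|split|move=> a A|move=> A B].
- by rewrite hmx1E; apply/block_constantP => i j p p' q q' *; rewrite !mxE.
- by apply/block_constantP => i j p p' q q' *; rewrite !mxE.
- move=> A B /block_constantP cA /block_constantP cB.
  apply/block_constantP => i j p p' q q' *.
  by rewrite !mxE (cA i j p p' q q') ?(cB i j p p' q q').
- move=> /block_constantP cA; apply/block_constantP => i j p p' q q' *.
  by rewrite !mxE (cA i j p p' q q').
- move=> /block_constantP cA /block_constantP cB; rewrite hmxME.
  apply/block_constantP => i j p p' q q' *.
  by rewrite !mxE (cA i j p p' q q') ?(cB i j p p' q q').
Qed.

HB.instance Definition _ := GRing.SubChoice_isSubAlgebra.Build C (hmx C N.+1)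
  (block_constant P) (blockmx P) block_constant_subalg.

Fact block_constant_star (A : hmx C N.+1) :
  block_constant P A -> block_constant P (star A).
Proof.
move=> /block_constantP cA; apply/block_constantP => i j p p' q q' *.
by rewrite !mxE (cA j i q q' p p').
Qed.

Definition blockmx_star (A : blockmx P) : blockmx P :=
  BlockMx (block_constant_star (blockmxP A)).

Fact blockmx_starK : involutive blockmx_star.
Proof. by move=> A; apply/val_inj/(@starK C (hmx C N.+1)). Qed.
Fact blockmx_starD : {morph blockmx_star : A B / A + B}.
Proof. by move=> A B; apply/val_inj/(@starD C (hmx C N.+1)). Qed.
Fact blockmx_starZ (a : C) A : blockmx_star (a *: A) = a^* *: blockmx_star A.
Proof. by apply/val_inj/(@starZ C (hmx C N.+1)). Qed.
Fact blockmx_starM A B :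
  blockmx_star (A * B) = blockmx_star B * blockmx_star A.
Proof. by apply/val_inj/(@starM C (hmx C N.+1)). Qed.

HB.instance Definition _ := Algebra_isStar.Build C (blockmx P)
  blockmx_starK blockmx_starD blockmx_starZ blockmx_starM.

Lemma blockmx1E : val (1 : blockmx P) = const_mx 1.
Proof. by []. Qed.
Lemma blockmxME (A B : blockmx P) : val (A * B) = map2_mx *%R (val A) (val B).
Proof. by []. Qed.
Lemma blockmx_starE (A : blockmx P) : val (star A) = (val A) ^t*.
Proof. by []. Qed.

End Algebra.

Definition compress_block N m (P : numbered_partition N m) (A : blockmx P) :
  hmx C m := compress P (val A).

Definition inflate_block N m (P : numbered_partition N m) (B : hmx C m) :
  blockmx P := BlockMx (inflate_block_constant P B).

End Blocks.

Arguments compress_block {C N m} P A.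
Arguments inflate_block {C N m} P B.
Arguments blockmx C {N m} P.

(* Main.v *)
Require Import Defs.
From mathcomp Require Import all_boot all_order all_algebra.
From mathcomp Require Import sesquilinear spectral.

(** A block-constant matrix is a small matrix whose rows and columns have been
repeated.  Send each point [p] to the index [block_of p] of its block, and
choose a point [block_rep i] in each block.  Inflation is then the reindexing
of a matrix along [block_of] ([inflateE]), and compression, being an average
of equal entries, is on block-constant matrices the reindexing along
[block_rep] ([compressE]).

Since [block_of] is a left inverse of [block_rep], and a block-constant matrix
does not change when each point is replaced by the representative of its
block, the two reindexings are mutually inverse.  The operations of the two
algebras are either entrywise or a transposition, so any reindexing that uses
the same function for rows and columns respects them.  Such a reindexing is also
a congruence [S *m A *m S ^t*] by a 0-1 matrix [S]; a congruence cannot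
increase the rank ([mxrank_mxsub_le]) and preserves positive semidefiniteness
([psdmx_mxsub]).  As this applies in both directions, rank and positive
semidefiniteness are the same on both sides. *)

Set Implicit Arguments.
Unset Strict Implicit.
Unset Printing Implicit Defensive.

Import Order.TTheory GRing.Theory Num.Theory.
Local Open Scope ring_scope.
Local Open Scope sesquilinear_scope.

Section Reindexing.

(** The outer factors are 0-1 matrices; for [g = f] they are transposes of each
other, which makes a simultaneous reindexing a congruence. *)
Lemma mxsub_mulmx (R : pzSemiRingType) m n m' n' (f : 'I_m' -> 'I_m)
    (g : 'I_n' -> 'I_n) (A : 'M[R]_(m, n)) :
  mxsub f g A = rowsub f 1%:M *m A *m colsub g 1%:M.
Proof. by rewrite -rowsubE -mxsub_mul mulmx1. Qed.

Lemma mxrank_mxsub_le (F : fieldType) m n m' n' (f : 'I_m' -> 'I_m)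
    (g : 'I_n' -> 'I_n) (A : 'M[F]_(m, n)) :
  (\rank (mxsub f g A) <= \rank A)%N.
Proof.
rewrite mxsub_mulmx.
exact: leq_trans (mxrankM_maxl _ _) (mxrankM_maxr _ _).
Qed.

Variable C : numClosedFieldType.

(** The quadratic form of the congruent matrix at [x] is that of [A] at
[S ^t* *m x]. *)
Lemma psdmx_congr m n (S : 'M[C]_(m, n)) (A : 'M[C]_n) :
  psdmx A -> psdmx (S *m A *m S ^t*).
Proof.
have trCM a b c (X : 'M[C]_(a, b)) (Y : 'M[C]_(b, c)) :
  (X *m Y) ^t* = Y ^t* *m X ^t* by rewrite trmx_mul map_mxM.
have trCK a b (X : 'M[C]_(a, b)) : (X ^t*) ^t* = X.
  by apply/matrixP=> i j; rewrite !mxE conjCK.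
case=> /is_hermitianmxP; rewrite expr0 scale1r => hA pA; split.
  by apply/is_hermitianmxP; rewrite expr0 scale1r !trCM trCK -hA mulmxA.
by move=> x; have := pA (S ^t* *m x); rewrite trCM trCK !mulmxA.
Qed.

Lemma psdmx_mxsub m n (f : 'I_m -> 'I_n) (A : 'M[C]_n) :
  psdmx A -> psdmx (mxsub f f A).
Proof.
move=> /(psdmx_congr (rowsub f 1%:M)).
have -> : (rowsub f 1%:M : 'M[C]_(m, n)) ^t* = colsub f 1%:M.
  by apply/matrixP=> i j; rewrite !mxE conjC_nat eq_sym.
by rewrite -mxsub_mulmx.
Qed.

End Reindexing.

Section Blocks.
Variables (N m : nat) (P : numbered_partition N m).

Fact block_ex p : exists i, p \in P i.
Proof.
case/and3P: (block_partition P) => /eqP covP _ _.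
have: p \in cover [set P i | i : 'I_m] by rewrite covP inE.
by case/bigcupP=> _ /imsetP[i _ ->]; exists i.
Qed.

Fact block_neq0 i : exists p, p \in P i.
Proof.
apply/set0Pn; apply/eqP=> Pi0; case/and3P: (block_partition P) => _ _ /negP.
by case; rewrite -Pi0 imset_f.
Qed.

Definition block_of p : 'I_m := xchoose (block_ex p).
Definition block_rep i : 'I_N := xchoose (block_neq0 i).

Lemma mem_block_of p : p \in P (block_of p).
Proof. exact: (xchooseP (block_ex p)). Qed.

Lemma mem_block_rep i : block_rep i \in P i.
Proof. exact: (xchooseP (block_neq0 i)). Qed.

Lemma mem_blockE p i : (p \in P i) = (i == block_of p).
Proof.
apply/idP/eqP=> [Pip | ->]; last exact: mem_block_of.
exact: block_mem_eq Pip (mem_block_of p).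
Qed.

Lemma block_repK : cancel block_rep block_of.
Proof. by move=> i; apply/esym/eqP; rewrite -mem_blockE mem_block_rep. Qed.

Variable C : numClosedFieldType.

(** As the blocks are disjoint, only the term of the double sum indexed by the
blocks of [p] and [q] contributes to the entry at [(p, q)]. *)
Lemma inflateE (B : 'M[C]_m) : inflate P B = mxsub block_of block_of B.
Proof.
apply/matrixP=> p q; rewrite mxE summxE (bigD1 (block_of p)) //=.
rewrite summxE (bigD1 (block_of q)) //= !mxE !mem_block_of mulr1.
rewrite !big1 ?addr0 // => [i /negPf ip | j /negPf jq].
  rewrite summxE big1 // => j _.
  by rewrite !mxE mem_blockE ip mulr0.
by rewrite !mxE andbC mem_blockE jq mulr0.
Qed.

(** The average of equal entries is any one of them, in particular the one at
the chosen representatives. *)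
Lemma compressE (A : blockmx C P) :
  compress P (val A) = mxsub block_rep block_rep (val A).
Proof.
have /block_constantP cA := blockmxP A.
have card_neq0 i : #|P i|%:R != 0 :> C.
  by rewrite pnatr_eq0 -lt0n card_gt0; apply/set0Pn/block_neq0.
apply/matrixP=> i j; rewrite !mxE.
transitivity ((#|P i|%:R * #|P j|%:R)^-1 *
    \sum_(p in P i) \sum_(q in P j) val A (block_rep i) (block_rep j)).
  congr (_ * _); apply: eq_bigr => p Pp; apply: eq_bigr => q Pq.
  exact: (cA i j) (mem_block_rep i) Pq (mem_block_rep j).
rewrite !sumr_const -[X in _ * X]mulr_natl -[X in _ * (_ * X)]mulr_natl.
by rewrite !mulrA -(mulrA _ #|P i|%:R) mulVf ?mul1r // mulf_neq0.
Qed.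

Lemma blockmx_rep (A : blockmx C P) p q :
  val A (block_rep (block_of p)) (block_rep (block_of q)) = val A p q.
Proof.
have /block_constantP cA := blockmxP A.
exact: cA (mem_block_rep _) (mem_block_of p) (mem_block_rep _) (mem_block_of q).
Qed.

Lemma compress_blockK :
  cancel (compress_block P : blockmx C P -> hmx C m) (inflate_block P).
Proof.
move=> A; apply: val_inj; rewrite /= /compress_block inflateE compressE.
by apply/matrixP=> p q; rewrite !mxE blockmx_rep.
Qed.

Lemma inflate_blockK :
  cancel (inflate_block P : hmx C m -> blockmx C P) (compress_block P).
Proof.
move=> B; rewrite /compress_block compressE /= inflateE.
by apply/matrixP=> i j; rewrite !mxE !block_repK.
Qed.

(** The matrix [B] and its inflation are reindexings of each other, so the inequality
of [mxrank_mxsub_le] holds both ways. *)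
Lemma mxrank_inflate_block (B : hmx C m) :
  \rank (val (inflate_block P B)) = \rank B.
Proof.
apply/eqP; rewrite eqn_leq; apply/andP; split.
  by rewrite /= inflateE mxrank_mxsub_le.
rewrite -{1}[B]inflate_blockK /compress_block compressE.
exact: mxrank_mxsub_le.
Qed.

Lemma psdmx_compress_block (A : blockmx C P) :
  psdmx (val A) <-> psdmx (compress_block P A).
Proof.
split=> psdA; first by rewrite /compress_block compressE; apply: psdmx_mxsub.
by rewrite -[A]compress_blockK /= inflateE; apply: psdmx_mxsub.
Qed.

End Blocks.

Section Morphisms.
Variables (C : numClosedFieldType) (N m : nat).
Variable P : numbered_partition N.+1 m.+1.

Lemma compress_block_morphism :
  star_alg_morphism (compress_block P : blockmx C P -> hmx C m.+1).
Proof.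
have compE A : compress_block P A = mxsub (block_rep P) (block_rep P) (val A).
  exact: compressE.
split=> [a A B||A]; last by rewrite !compE; apply/matrixP=> i j; rewrite !mxE.
- by rewrite !compE; apply/matrixP=> i j; rewrite !mxE.
- split=> [|A B]; rewrite !compE; first by apply/matrixP=> i j; rewrite !mxE.
  by rewrite hmxME blockmxME; apply/matrixP=> i j; rewrite !mxE.
Qed.

Lemma inflate_block_morphism :
  star_alg_morphism (inflate_block P : hmx C m.+1 -> blockmx C P).
Proof.
have inflE (B : hmx C m.+1) :
  val (inflate_block P B) = mxsub (block_of P) (block_of P) B.
  exact: inflateE.
split=> [a A B||A]; last first.
- apply: val_inj; rewrite blockmx_starE !inflE.
  by apply/matrixP=> i j; rewrite !mxE.
- split=> [|A B]; apply: val_inj.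
    by rewrite blockmx1E inflE; apply/matrixP=> i j; rewrite !mxE.
  by rewrite blockmxME !inflE; apply/matrixP=> i j; rewrite !mxE.
- apply: val_inj; rewrite inflE GRing.valD GRing.valZ !inflE.
  by apply/matrixP=> i j; rewrite !mxE.
Qed.

End Morphisms.

Theorem theorem4p2 (R : realType) (N m : nat)
    (P : numbered_partition N.+1 m.+1) :
  [/\ mutually_inverse_star_alg_isos
        (compress_block P : blockmx R[i] P -> hmx R[i] m.+1)
        (inflate_block P : hmx R[i] m.+1 -> blockmx R[i] P),
      forall A : blockmx R[i] P, \rank (compress_block P A) = \rank (val A),
      forall B : hmx R[i] m.+1, \rank (val (inflate_block P B)) = \rank B
    & forall A : blockmx R[i] P, psdmx (val A) <-> psdmx (compress_block P A)].

Proof.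
split=> [|A|B|A].
- split; [exact: compress_block_morphism | exact: inflate_block_morphism
    | exact: compress_blockK | exact: inflate_blockK].
- by rewrite -{2}[A]compress_blockK mxrank_inflate_block.
- exact: mxrank_inflate_block.
- exact: psdmx_compress_block.
Qed.
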